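(* Let $A\in\mathbb{R}^{n\times n}$ be symmetric positive semidefinite, let $B\in\mathbb{R}^{n\times n}$ be symmetric positive definite, and let $P\in\mathbb{R}^{n\times n}$ be an invertible matrix such that $\tilde B:=P^{-T}BP^{-1}=I$. Put $\tilde A=P^{-T}AP^{-1}$. Consider the iteration $$y_k=Px_k,\qquad y_{k+1}=y_k-\alpha\left(2\tilde By_k-\frac{\tilde Ay_k}{(y_k^T\tilde Ay_k)^{1/2}}\right),\qquad x_{k+1}=P^{-1}y_{k+1}$$ with fixed stepsize $\alpha\equiv 1/2$. Then this iteration is equivalent, ignoring normalization, to the power method for the generalized eigenvalue problem of $(A,B)$: for every $x_k$ with $Ax_k\neq 0$, there is a scalar $c_k>0$ such that $x_{k+1}=c_kB^{-1}Ax_k$.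
   Context: The power method for the generalized eigenvalue problem $Au=\lambda Bu$ is the iteration that maps $x_k$ to (a normalization of) $B^{-1}Ax_k$. $P^{-T}$ denotes $(P^{-1})^T$. *)

(* Defs.v *)
From mathcomp Require Import all_boot all_order all_algebra.
From mathcomp Require Import reals.

Set Implicit Arguments.
Unset Strict Implicit.
Unset Printing Implicit Defensive.

Import Order.TTheory GRing.Theory Num.Theory.
Local Open Scope ring_scope.

(* [x^T *m M *m x] is a 1 x 1 matrix; [quad_form] is its only entry. *)
Definition quad_form (R : realType) (n : nat) (M : 'M[R]_n) (x : 'cV[R]_n) : R :=
  (x^T *m M *m x) 0 0.

Definition sym_psd (R : realType) (n : nat) (M : 'M[R]_n) : Prop :=
  M \is symmetricmx /\ forall x : 'cV[R]_n, 0 <= quad_form M x.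

Definition sym_pd (R : realType) (n : nat) (M : 'M[R]_n) : Prop :=
  M \is symmetricmx /\ forall x : 'cV[R]_n, x != 0 -> 0 < quad_form M x.

(* P^{-T} M P^{-1} *)
Definition congr_inv (R : realType) (n : nat) (P M : 'M[R]_n) : 'M[R]_n :=
  (invmx P)^T *m M *m invmx P.

(* The gradient step in the variable y, for given matrices At, Bt. It is
   meaningful where [0 < quad_form At y]; elsewhere [0^-1 = 0] and
   [Num.sqrt a = 0] for [a <= 0] make the last term vanish. *)
Definition y_step (R : realType) (n : nat) (alpha : R) (At Bt : 'M[R]_n)
    (y : 'cV[R]_n) : 'cV[R]_n :=
  y - alpha *: (2 *: (Bt *m y) - (Num.sqrt (quad_form At y))^-1 *: (At *m y)).

(* The map x_k |-> x_{k+1}. *)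
Definition x_step (R : realType) (n : nat) (alpha : R) (A B P : 'M[R]_n)
    (x : 'cV[R]_n) : 'cV[R]_n :=
  invmx P *m y_step alpha (congr_inv P A) (congr_inv P B) (P *m x).

(* Main.v *)
(** With stepsize 1/2 and [Bt = 1] the terms [y] and [alpha *: (2 *: y)] cancel,
    so the step is [x |-> c *: P^-1 (P^-T A P^-1) (P x) = c *: P^-1 P^-T A x] with
    [c = 1 / (2 sqrt (x^T A x))], and [P^-1 P^-T = B^-1]. Positivity of [c] rests
    on the fact that [x^T A x = 0] forces [A x = 0] when [A] is positive
    semidefinite: otherwise the form would be negative at some point of the line
    [x + t A x]. *)
Require Import Defs.
From mathcomp Require Import all_boot all_order all_algebra.
From mathcomp Require Import reals.
From mathcomp Require Import ring.
Import Order.TTheory GRing.Theory Num.Theory.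
Local Open Scope ring_scope.

Lemma tr_mul_col_gt0 (R : realType) (n : nat) (z : 'cV[R]_n) :
  z != 0 -> 0 < (z^T *m z) 0 0.
Proof.
move=> z0; rewrite mxE.
under eq_bigr => i _ do rewrite mxE -expr2.
rewrite lt0r sumr_ge0 ?andbT => [|i _]; last exact: sqr_ge0.
apply: contraNN z0; rewrite psumr_eq0 => [/allP h|i _]; last exact: sqr_ge0.
apply/eqP/colP => i; rewrite mxE; apply/eqP.
by rewrite -sqrf_eq0; apply: h; rewrite mem_index_enum.
Qed.

(** Symmetry of [M] merges the two cross terms. The linear coefficient is written with [M *m x] so
    that the choice [z = M *m x] turns it into twice a sum of squares. *)
Lemma quad_form_line (R : realType) (n : nat) (M : 'M[R]_n) (x z : 'cV[R]_n)
    (t : R) :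
  M \is symmetricmx ->
  quad_form M (x + t *: z) =
    quad_form M x + 2 * t * (z^T *m (M *m x)) 0 0 + t ^+ 2 * quad_form M z.
Proof.
(* [symmetricmx] means hermitian with sign [(-1) ^+ 0] and identity conjugation; both are cleared
   here. *)
move=> /is_hermitianmxP hM0; have hM : M^T = M.
  by rewrite {2}hM0 expr0 scale1r map_mx_id.
rewrite /quad_form; have hC : x^T *m M *m z = z^T *m (M *m x).
  have -> : z^T *m (M *m x) = (x^T *m M *m z)^T.
    by rewrite !trmx_mul trmxK hM.
  by apply/matrixP => i j; rewrite [RHS]mxE !ord1.
have -> : (x + t *: z)^T = x^T + t *: z^T by apply/matrixP => i j; rewrite !mxE.
rewrite !mulmxDl !mulmxDr.
rewrite -!scalemxAl -!scalemxAr hC -[z^T *m M *m x]mulmxA !mxE; ring.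
Qed.

Lemma quad_form_gt0 (R : realType) (n : nat) (M : 'M[R]_n) (x : 'cV[R]_n) :
  sym_psd M -> M *m x != 0 -> 0 < quad_form M x.
Proof.
move=> [hM psdM] Mx0; rewrite lt0r psdM andbT; apply/eqP => qx0.
have s0 := tr_mul_col_gt0 _ _ _ Mx0; set s := (X in 0 < X) in s0.
have a0 := psdM (M *m x); set a := quad_form _ _ in a0.
have a1 : 0 < a + 1 by rewrite ltr_wpDl.
(* [t] nearly minimizes [2 t s + a t ^+ 2]; the [+ 1] avoids dividing by 0. *)
pose t := - (s / (a + 1)).
have := psdM (x + t *: (M *m x)); rewrite quad_form_line // qx0 -/s -/a.
apply/negP; rewrite -ltNge.
have -> : 0 + 2 * t * s + t ^+ 2 * a = - (s / (a + 1)) ^+ 2 * (a + 2).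
  by rewrite /t; field; rewrite gt_eqF.
rewrite mulNr oppr_lt0 mulr_gt0 ?exprn_gt0 ?divr_gt0 //.
by rewrite ltr_wpDl.
Qed.

Lemma quad_form_congr_inv (R : realType) (n : nat) (P M : 'M[R]_n)
    (x : 'cV[R]_n) :
  P \in unitmx -> quad_form (congr_inv P M) (P *m x) = quad_form M x.
Proof.
move=> hP; rewrite /quad_form /congr_inv trmx_mul !mulmxA.
by rewrite -(mulmxA x^T P^T) -trmx_mul mulVmx // trmx1 mulmx1 mulmxKV.
Qed.

(** A one-sided inverse of a square matrix is two-sided, so the factor [P^-T] can be moved
    cyclically to the right, giving [B (P^-1 P^-T) = 1]. This also yields the invertibility of
    [B]. *)
Lemma invmx_congr_inv1 (R : realType) (n : nat) (P B : 'M[R]_n) :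
  congr_inv P B = 1%:M -> invmx B = invmx P *m (invmx P)^T.
Proof.
rewrite /congr_inv -mulmxA => /mulmx1C; rewrite -mulmxA => hBV.
have [hBu _] := mulmx1_unit hBV.
by rewrite -[RHS](mulKmx hBu) hBV mulmx1.
Qed.

Theorem theorem3p10 (R : realType) (n : nat) (A B P : 'M[R]_n)
    (hA : sym_psd A) (hB : sym_pd B) (hP : P \in unitmx)
    (hBt : congr_inv P B = 1%:M) :
  forall x : 'cV[R]_n, A *m x != 0 ->
    exists c : R, 0 < c /\ x_step 2^-1 A B P x = c *: (invmx B *m (A *m x)).
Proof.
move=> x Ax0; have q0 := quad_form_gt0 _ _ _ _ hA Ax0.
exists (2^-1 * (Num.sqrt (quad_form A x))^-1); split.
  by rewrite mulr_gt0 ?invr_gt0 ?sqrtr_gt0.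
rewrite /x_step /y_step quad_form_congr_inv // hBt mul1mx scalerBr !scalerA.
rewrite mulVf ?pnatr_eq0 // scale1r opprB addrC subrK.
by rewrite -scalemxAr (invmx_congr_inv1 _ _ _ _ hBt) /congr_inv !mulmxA mulmxKV.
Qed.
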